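(* Let $H$ be a graph. The class of $H$-free graphs is bounded-apex-complete-multipartite if and only if $H$ is an induced subgraph of $K_2 + K_1$.
   Context: All graphs are finite and simple. $K_2+K_1$ is the disjoint union of an edge and a single vertex. ''Induced subgraph of $X$'' means isomorphic to $X[S]$ for some $S\subseteq V(X)$. A graph is $H$-free if none of its induced subgraphs is isomorphic to $H$. A graph $G$ is complete multipartite if $V(G)$ can be partitioned into sets $V_1,\dots,V_k$, $k\ge 1$, such that for all $u\in V_i$, $v\in V_j$, we have $uv\in E(G)$ if and only if $i\ne j$. A class of graphs is bounded-apex-complete-multipartite if there is a constant $c\in\mathbb{N}$ such that every graph $G$ in the class has a set $S\subseteq V(G)$ with $|S|\le c$ such that $G-S$ is complete multipartite. *)

(* Defs.v *)
From mathcomp Require Import all_boot.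

Set Implicit Arguments.
Unset Strict Implicit.
Unset Printing Implicit Defensive.

(* The vertex set may be empty. *)
Record sgraph := SGraph {
  vertex :> finType;
  adj : rel vertex;
  adj_sym : symmetric adj;
  adj_irrefl : irreflexive adj
}.

Definition graph_class := sgraph -> Prop.

Definition isomorphic (G H : sgraph) : Prop :=
  exists2 f : G -> H, bijective f & forall x y : G, adj (f x) (f y) = adj x y.

Section Induced.

Variables (G : sgraph) (S : {set G}).

Definition induced_adj : rel {x : G | x \in S} :=
  fun x y => adj (val x) (val y).

Lemma induced_sym : symmetric induced_adj.
Proof. by move=> x y; exact: adj_sym. Qed.

Lemma induced_irrefl : irreflexive induced_adj.
Proof. by move=> x; exact: adj_irrefl. Qed.

Definition induced : sgraph := SGraph induced_sym induced_irrefl.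

End Induced.

Definition delete_vertices (G : sgraph) (S : {set G}) : sgraph :=
  induced (~: S).

Definition induced_subgraph (H G : sgraph) : Prop :=
  exists S : {set G}, isomorphic H (induced S).

Definition free (H : sgraph) : graph_class :=
  fun G => ~ induced_subgraph H G.

Section Complete.

Variable n : nat.

Definition complete_adj : rel 'I_n := fun i j => i != j.

Lemma complete_sym : symmetric complete_adj.
Proof. by move=> i j; rewrite /complete_adj eq_sym. Qed.

Lemma complete_irrefl : irreflexive complete_adj.
Proof. by move=> i; rewrite /complete_adj eqxx. Qed.

Definition complete : sgraph := SGraph complete_sym complete_irrefl.

End Complete.

Section DisjointUnion.

Variables G H : sgraph.

Definition disjoint_union_adj : rel (G + H)%type :=
  fun x y => match x, y with
             | inl u, inl v => adj u v
             | inr u, inr v => adj u v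
             | _, _ => false
             end.

Lemma disjoint_union_sym : symmetric disjoint_union_adj.
Proof. by move=> [x|x] [y|y] //=; exact: adj_sym. Qed.

Lemma disjoint_union_irrefl : irreflexive disjoint_union_adj.
Proof. by move=> [x|x] /=; exact: adj_irrefl. Qed.

Definition disjoint_union : sgraph :=
  SGraph disjoint_union_sym disjoint_union_irrefl.

End DisjointUnion.

(* Parts may be empty, so the graph with no vertices is complete multipartite. *)
Definition complete_multipartite (G : sgraph) : Prop :=
  exists (k : nat) (V : 'I_k -> {set G}),
    [/\ 1 <= k,
        \bigcup_(i < k) V i = [set: G],
        forall i j : 'I_k, i != j -> [disjoint V i & V j]
      & forall (i j : 'I_k) (u v : G),
          u \in V i -> v \in V j -> (adj u v <-> i <> j)].

Definition bounded_apex_complete_multipartite (C : graph_class) : Prop :=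
  exists c : nat, forall G : sgraph, C G ->
    exists S : {set G},
      #|S| <= c /\ complete_multipartite (delete_vertices S).

(* Main.v *)
Require Import Defs.
From mathcomp Require Import all_boot.

Set Implicit Arguments.
Unset Strict Implicit.
Unset Printing Implicit Defensive.

(** A graph is complete multipartite exactly when non-adjacency is transitive,
    that is, when it has no induced [K_2 + K_1] ([complete_multipartiteP]).
    Hence, if [H] embeds into [K_2 + K_1], every [H]-free graph is already
    complete multipartite and no vertex needs to be deleted.

    Conversely, three families of graphs stay far from complete multipartite:
    the matchings [n K_2], the pairs of cliques [2 K_n], and the graphs
    [K_n + n K_1].  Each of them lives on [n] rows of two vertices, with an
    adjacency that looks only at whether two rows are equal and at the two
    positions ([row_graph]).  Deleting [c] vertices from [c + 2] rows leaves two
    rows intact, and two rows already contain an induced [K_2 + K_1].  So if the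
    [H]-free graphs have bounded apex number, [H] embeds into a member of each
    family ([bounded_apex_embeds_row_graph]).  The matching bounds the degrees
    of [H] by one, the two cliques forbid three independent vertices, and the
    clique with isolated vertices forbids two independent edges; what remains is
    an induced subgraph of [K_2 + K_1]. *)

(** * Induced subgraphs as embeddings *)

Definition embedding (H G : sgraph) (f : H -> G) : Prop :=
  injective f /\ forall x y, adj (f x) (f y) = adj x y.

Lemma induced_subgraphP (H G : sgraph) :
  induced_subgraph H G <-> exists f : H -> G, embedding f.
Proof.
split=> [[S [f /bij_inj f_inj f_adj]] | [f [f_inj f_adj]]].
  exists (fun x => val (f x)); split=> [x y /val_inj/f_inj // | x y].
  by rewrite -f_adj.
pose S := [set f x | x : H].
have fS x : f x \in S by exact: imset_f.
exists S, (fun x => exist _ (f x) (fS x) : induced S) => //.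
apply: inj_card_bij => [x y [/f_inj] // |].
by rewrite card_sig; exact: leq_imset_card.
Qed.

Lemma induced_subgraph_trans (G H K : sgraph) :
  induced_subgraph H G -> induced_subgraph G K -> induced_subgraph H K.
Proof.
move=> /induced_subgraphP[f [f_inj f_adj]] /induced_subgraphP[g [g_inj g_adj]].
apply/induced_subgraphP; exists (g \o f); split; first exact: inj_comp.
by move=> x y /=; rewrite g_adj.
Qed.

Lemma induced_sub (G : sgraph) (S : {set G}) : induced_subgraph (induced S) G.
Proof. by apply/induced_subgraphP; exists val; split; first exact: val_inj. Qed.

(** Only finitely many maps are candidates, so the double negation coming from
    freeness can be removed without excluded middle. *)
Lemma not_free_induced (H G : sgraph) : ~ free H G -> induced_subgraph H G.
Proof.
pose emb (f : {ffun H -> G}) :=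
  injectiveb f && [forall x, forall y, adj (f x) (f y) == adj x y].
case: (boolP [exists f, emb f]) => [/existsP[f] | no_emb not_free].
  case/andP=> /injectiveP f_inj /forallP f_adj _.
  apply/induced_subgraphP; exists f; split=> // x y.
  exact/eqP/(forallP (f_adj x)).
case: not_free => /induced_subgraphP[f [f_inj f_adj]].
case/existsP: no_emb; exists (finfun f); apply/andP; split.
  by apply/injectiveP => x y; rewrite !ffunE => /f_inj.
by apply/forallP => x; apply/forallP => y; rewrite !ffunE f_adj.
Qed.

(** * Complete multipartite graphs *)

(** If non-adjacency is transitive, non-adjacent vertices have the same
    neighbourhood, whereas adjacent vertices never do; so the parts can be taken
    to be the classes of vertices with a common neighbourhood. *)
Lemma complete_multipartiteP (G : sgraph) :
  complete_multipartite G <->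
  forall u v w : G, ~~ adj u w -> ~~ adj w v -> ~~ adj u v.
Proof.
split=> [[k [V [_ Vcover _ Vadj]]] u v w Nuw Nwv | Ntrans].
  have part x : {i | x \in V i}.
    apply: sigW; have: x \in [set: G] by rewrite inE.
    by rewrite -Vcover => /bigcupP[i _ xVi]; exists i.
  have [[i ui] [j vj]] := (part u, part v); have [l wl] := part w.
  have same a b x y : x \in V a -> y \in V b -> ~~ adj x y -> a = b.
    move=> xa yb; apply: contraNeq => /eqP ab.
    exact/(Vadj _ _ _ _ xa yb).
  apply/negP => uv; apply: ((Vadj _ _ _ _ ui vj).1 uv).
  by rewrite (same _ _ _ _ ui wl Nuw) (same _ _ _ _ wl vj Nwv).
pose N (v : G) := [set u | adj v u].
have adjN u v : adj u v <-> N u <> N v.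
  split=> [uv eqN | neqN].
    by have:= uv; rewrite -[adj u v](in_set (adj u)) -/(N u) eqN inE adj_irrefl.
  apply/negPn/negP => Nuv; apply: neqN; apply/setP => w; rewrite !inE.
  apply/idP/idP; apply: contraLR => Nw; first exact: Ntrans Nuv Nw.
  by apply: Ntrans Nw; rewrite adj_sym.
exists #|{: {set G}}|, (fun i => [set v | enum_rank (N v) == i]); split.
- by apply/card_gt0P; exists set0.
- apply/setP => v; rewrite in_setT; apply/bigcupP.
  by exists (enum_rank (N v)) => //; rewrite inE.
- move=> i j neq_ij; rewrite -setI_eq0; apply/eqP/setP => v; rewrite !inE.
  by apply/negP => /andP[/eqP-> /eqP eq_ij]; rewrite eq_ij eqxx in neq_ij.
move=> i j u v; rewrite !inE => /eqP <- /eqP <-.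
split=> [/adjN neqN /enum_rank_inj // | neq_rank].
by apply/adjN => eqN; apply: neq_rank; rewrite eqN.
Qed.

Lemma complete_multipartite_induced (G H : sgraph) :
  induced_subgraph H G -> complete_multipartite G -> complete_multipartite H.
Proof.
move=> /induced_subgraphP[f [_ f_adj]] /complete_multipartiteP Ntrans.
apply/complete_multipartiteP => u v w; rewrite -!f_adj; exact: Ntrans.
Qed.

Lemma free_K2_K1_complete_multipartite (G : sgraph) :
  free (disjoint_union (complete 2) (complete 1)) G -> complete_multipartite G.
Proof.
move=> G_free; apply/complete_multipartiteP => u v w Nuw Nwv.
apply/negP => uv; apply: G_free; apply/induced_subgraphP.
exists (fun x : 'I_2 + 'I_1 =>
          match x with inl i => if i == ord0 then u else v | inr _ => w end).
have Nwu : adj w u = false by rewrite adj_sym (negbTE Nuw).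
have Nvw : adj v w = false by rewrite adj_sym (negbTE Nwv).
have neq_uv : u <> v by move=> eq_uv; rewrite eq_uv adj_irrefl in uv.
have neq_uw : u <> w by move=> eq_uw; rewrite -eq_uw uv in Nwv.
have neq_vw : v <> w by move=> eq_vw; rewrite -eq_vw uv in Nuw.
split.
  by case=> [[[|[|//]] p]|[[|//] p]] [[[|[|//]] q]|[[|//] q]] //= eq_xy;
    first [ by congr inl; apply: val_inj | by congr inr; apply: val_inj
          | by case: neq_uv | by case: neq_uw | by case: neq_vw ].
by case=> [[[|[|//]] p]|[[|//] p]] [[[|[|//]] q]|[[|//] q]] //=;
  rewrite ?adj_irrefl ?uv ?Nwu ?Nvw ?(negbTE Nuw) ?(negbTE Nwv) // adj_sym uv.
Qed.

(** * Graphs built from rows of two vertices *)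

Section RowGraph.

(** The first argument of [e] tells whether the two vertices share a row, the
    other two are their positions in their rows. *)
Variables (e : bool -> bool -> bool -> bool).
Hypothesis e_sym : forall s b d, e s b d = e s d b.
Hypothesis e_irrefl : forall b, e true b b = false.

Section Rows.

Variable I : finType.

Definition row_adj : rel (I * bool) := fun x y => e (x.1 == y.1) x.2 y.2.

Lemma row_sym : symmetric row_adj.
Proof. by move=> x y; rewrite /row_adj eq_sym e_sym. Qed.

Lemma row_irrefl : irreflexive row_adj.
Proof. by move=> x; rewrite /row_adj eqxx e_irrefl. Qed.

Definition row_graph : sgraph := SGraph row_sym row_irrefl.

End Rows.

(** At most [c] of the [c + 2] rows meet [S]; since the adjacency depends only on
    equality of rows, any two of the others induce the graph on two rows. *)
Lemma two_rows_survive c (S : {set row_graph 'I_c.+2}) :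
  #|S| <= c -> induced_subgraph (row_graph bool) (delete_vertices S).
Proof.
move=> leSc; pose touched := [set x.1 | x in S].
have : 1 < #|~: touched|.
  rewrite cardsCs setCK card_ord ltn_subRL addn1 !ltnS.
  exact: leq_trans (leq_imset_card _ _) leSc.
case/card_gt1P=> i [j [iS jS neq_ij]].
pose row s := if s then i else j.
have row_out (x : bool * bool) : (row x.1, x.2) \in ~: S.
  have : row x.1 \in ~: touched by case: x.1.
  rewrite !inE; apply: contra => xS; exact: (imset_f fst xS).
have eq_row s t : (row s == row t) = (s == t).
  case: s; case: t; rewrite /= ?eqxx ?(negbTE neq_ij) //.
  by rewrite eq_sym (negbTE neq_ij).
apply/induced_subgraphP.
exists (fun x : row_graph bool =>
          exist _ (row x.1, x.2) (row_out x) : delete_vertices S).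
split=> [[s b] [t d] [] /eqP | x y].
  by rewrite eq_row => /eqP -> ->.
by rewrite /= /induced_adj /= /row_adj /= eq_row.
Qed.

(** When two rows are not complete multipartite, no [c] vertices can be removed
    from [c + 2] rows to leave a complete multipartite graph, so the graph on
    [c + 2] rows is not [H]-free as soon as [c] bounds the apex number. *)
Lemma bounded_apex_embeds_row_graph (H : sgraph) :
    bounded_apex_complete_multipartite (free H) ->
    ~ complete_multipartite (row_graph bool) ->
  exists n, induced_subgraph H (row_graph 'I_n).
Proof.
move=> [c apex] not_cm; exists c.+2; apply: not_free_induced => /apex[S [leSc]].
by move/(complete_multipartite_induced (two_rows_survive leSc)).
Qed.

End RowGraph.

(** * Consequences of bounded apex number *)

Section Obstructions.

Variable H : sgraph.
Hypothesis H_apex : bounded_apex_complete_multipartite (free H).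

(** From the matchings [n K_2], whose edges are the rows. *)
Lemma bounded_apex_degree_le1 (x y z : H) : adj x y -> adj x z -> y = z.
Proof.
pose e (s b d : bool) := s && (b != d).
have e_sym s b d : e s b d = e s d b by rewrite /e eq_sym.
have e_irr b : e true b b = false by rewrite /e eqxx.
have [|n /induced_subgraphP[f [f_inj f_adj]]] :=
  @bounded_apex_embeds_row_graph e e_sym e_irr H H_apex.
  (* An edge and a common non-neighbour of its ends, inside two rows. *)
  move/complete_multipartiteP.
  by move/(_ (false, false) (false, true) (true, false) isT isT).
rewrite -!f_adj /= /row_adj /e => /andP[/eqP xy bxy] /andP[/eqP xz bxz].
apply: f_inj; apply/eqP; rewrite -pair_eqE /pair_eq -xy -xz eqxx /=.
by move: bxy bxz; case: (f x).2; case: (f y).2; case: (f z).2.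
Qed.

(** From the graphs [2 K_n], whose cliques are the two columns: two of any three
    vertices lie in the same column. *)
Lemma bounded_apex_no_3_independent (x y z : H) :
  x != y -> x != z -> y != z -> [|| adj x y, adj x z | adj y z].
Proof.
pose e (s b d : bool) := ~~ s && (b == d).
have e_sym s b d : e s b d = e s d b by rewrite /e eq_sym.
have e_irr b : e true b b = false by [].
have [|n /induced_subgraphP[f [f_inj f_adj]]] :=
  @bounded_apex_embeds_row_graph e e_sym e_irr H H_apex.
  (* An edge and a common non-neighbour of its ends, inside two rows. *)
  move/complete_multipartiteP.
  by move/(_ (false, false) (true, false) (false, true) isT isT).
rewrite -!f_adj -!(inj_eq f_inj) /= /row_adj /e -!pair_eqE /pair_eq.
by case: (f x).2; case: (f y).2; case: (f z).2; rewrite /= ?andbT ?andbF => // *;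
  apply/or3P; constructor.
Qed.

(** From the graphs [K_n + n K_1], with one clique column and one independent
    column: all vertices incident with an edge lie in the clique, so any two of
    them are equal or adjacent. *)
Lemma bounded_apex_no_2_independent_edges (x y z w : H) :
  adj x y -> adj z w -> (x == z) || adj x z.
Proof.
pose e (s b d : bool) := [&& ~~ s, b & d].
have e_sym s b d : e s b d = e s d b by rewrite /e [b && d]andbC.
have e_irr b : e true b b = false by [].
have [|n /induced_subgraphP[f [f_inj f_adj]]] :=
  @bounded_apex_embeds_row_graph e e_sym e_irr H H_apex.
  (* An edge and a common non-neighbour of its ends, inside two rows. *)
  move/complete_multipartiteP.
  by move/(_ (false, true) (true, true) (false, false) isT isT).
rewrite -!f_adj -(inj_eq f_inj) /= /row_adj /e -pair_eqE /pair_eq.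
move=> /and3P[_ -> _] /and3P[_ -> _]; rewrite eqxx !andbT; exact: orbN.
Qed.

(** If [H] has an edge [u v], every vertex incident with an edge is [u] or [v],
    so two further vertices would form an independent set with [u].  If [H] has
    no edge, it has at most two vertices. *)
Lemma bounded_apex_induced_K2_K1 :
  induced_subgraph H (disjoint_union (complete 2) (complete 1)).
Proof.
apply/induced_subgraphP.
case: (pickP [pred p : H * H | adj p.1 p.2]) => [[u v] /= uv | no_edge].
  have isolated x y : x != u -> x != v -> adj x y = false.
    move=> xu xv; apply/negP => xy.
    have := bounded_apex_no_2_independent_edges uv xy.
    rewrite eq_sym (negbTE xu) /= => ux.
    by rewrite (bounded_apex_degree_le1 ux uv) eqxx in xv.
  exists (fun x => if x == u then inl ord0
                   else if x == v then inl ord_max else inr ord0).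
  split=> x y.
    case: (eqVneq x u) => [->|xu]; last case: (eqVneq x v) => [->|xv];
      (case: (eqVneq y u) => [->|yu]; last case: (eqVneq y v) => [->|yv]) => // _.
    apply/eqP; apply: contraT => xy.
    have := @bounded_apex_no_3_independent x y u xy xu yu.
    by rewrite !isolated.
  have vu : adj v u by rewrite adj_sym.
  case: (eqVneq x u) => [->|xu]; last case: (eqVneq x v) => [->|xv];
    (case: (eqVneq y u) => [->|yu]; last case: (eqVneq y v) => [->|yv]) => /=;
    by [ rewrite adj_irrefl | rewrite uv | rewrite vu | rewrite isolated
       | rewrite adj_sym isolated ].
have Nadj x y : adj x y = false := no_edge (x, y).
(* One arbitrarily chosen vertex goes to an end of the edge, the other one, if
   any, to the isolated vertex. *)
exists (fun x => if [pick y : H] == Some x then inl ord0 else inr ord0).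
split=> x y; last by rewrite Nadj; do 2!case: ifP.
case: pickP => [u _ | /(_ x) //]; rewrite !(inj_eq Some_inj).
case: (eqVneq u x) (eqVneq u y) => [<-|ux] [<-|uy] // _.
apply/eqP; apply: contraT => xy.
by have := bounded_apex_no_3_independent ux uy xy; rewrite !Nadj.
Qed.

End Obstructions.

Theorem theorem10p1 (H : sgraph) :
  bounded_apex_complete_multipartite (free H) <->
  induced_subgraph H (disjoint_union (complete 2) (complete 1)).
Proof.
split; first exact: bounded_apex_induced_K2_K1.
move=> HK; exists 0 => G G_free; exists set0; rewrite cards0; split=> //.
apply: free_K2_K1_complete_multipartite => KG; apply: G_free.
apply: induced_subgraph_trans HK (induced_subgraph_trans KG _).
exact: induced_sub.
Qed.
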